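(* Let $n\ge 1$ be an integer. Against a uniformly random secret $\sigma\in S_n$ in Permutation Wordle on $[n]$, every strategy (possibly randomized) requires at least $(n+1)/2$ guesses in expectation, and the strategy CircularShift achieves this, i.e. its expected number of guesses is exactly $(n+1)/2$.
   Context: Let $[n]=\{1,\dots,n\}$ and let $S_n$ be the group of permutations of $[n]$. Permutation Wordle: a setter fixes a secret $\sigma\in S_n$. In round $r=1,2,\dots$ the guesser submits a word $\gamma_r\in[n]^n$ (not necessarily a permutation), regarded as a function $\gamma_r:[n]\to[n]$ from positions to values, and receives the feedback $U_r=\{i\in[n] : \gamma_r(i)=\sigma(i)\}$. A deterministic strategy is a rule specifying, for each $r\ge 1$, the guess $\gamma_r\in[n]^n$ as a function of the previous feedback $(U_1,\dots,U_{r-1})$. A randomized strategy may in addition use internal coin flips that are independent of the secret; equivalently, it is a random choice of deterministic strategy, made independently of $\sigma$. The number of guesses taken is the least $r\ge 1$ with $\gamma_r=\sigma$ (and $\infty$ if there is none); if it is not almost surely finite, its expectation is $\infty$. CircularShift is the following deterministic strategy. The first guess $\gamma_1$ is the identity permutation. After submitting $\gamma_r$ and receiving $U_r$: if $U_r=[n]$, stop (the secret is solved in $r$ rounds). Otherwise write $[n]\setminus U_r=\{a_1<\cdots<a_\ell\}$ and define $\gamma_{r+1}(i)=\gamma_r(i)$ if $i\in U_r$; $\gamma_{r+1}(a_j)=\gamma_r(a_{j-1})$ for $1<j\le \ell$; and $\gamma_{r+1}(a_1)=\gamma_r(a_\ell)$. *)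

(* Defs.v *)
From HB Require Import structures.
From mathcomp Require Import all_boot all_order all_algebra all_fingroup.
From mathcomp Require Import all_classical all_reals all_analysis.

Set Implicit Arguments.
Unset Strict Implicit.
Unset Printing Implicit Defensive.

Import Order.TTheory GRing.Theory Num.Theory.

Local Open Scope classical_set_scope.
Local Open Scope ring_scope.

(* Positions and values are both 0-based: [n] is 'I_n. *)
Notation word n := {ffun 'I_n -> 'I_n}.

Definition feedback n (g : word n) (sigma : 'S_n) : {set 'I_n} :=
  [set i | g i == sigma i].

(* The argument is the list U_1, ..., U_(r-1) in chronological order (so its
   length determines r); the value is the guess submitted in round r. *)
Definition strategy (n : nat) : Type := seq {set 'I_n} -> word n.

(* history s sigma k = [:: U_1; ...; U_k] *)
Fixpoint history n (s : strategy n) (sigma : 'S_n) (k : nat) :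
    seq {set 'I_n} :=
  if k is k'.+1 then
    rcons (history s sigma k') (feedback (s (history s sigma k')) sigma)
  else [::].

(* Rounds are numbered from 1; the value at r = 0 is not used. *)
Definition guess n (s : strategy n) (sigma : 'S_n) (r : nat) : word n :=
  s (history s sigma r.-1).

(* The infimum of the empty set is +oo. *)
Definition num_guesses (R : realType) n (s : strategy n) (sigma : 'S_n) :
    \bar R :=
  ereal_inf [set r%:R%:E | r in [set r | (0 < r)%N /\ guess s sigma r =1 sigma]].

(* [enum (~: U)] lists the complement of U in increasing order, and [prev] takes
   the cyclic predecessor in that list. *)
Definition circular_step n (g : word n) (U : {set 'I_n}) : word n :=
  [ffun i => if i \in U then g i else g (prev (enum (~: U)) i)].

Definition circular_shift n : strategy n :=
  foldl (@circular_step n) [ffun i => i].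

Section RandomGame.
Context (R : realType) (n : nat) (d : measure_display) (Omega : measurableType d).
Variable P : probability Omega R.

Definition uniform_secret (X : Omega -> 'S_n) : Prop :=
  forall sigma : 'S_n, measurable [set w | X w = sigma] /\
    P [set w | X w = sigma] = (n`!%:R^-1)%:E.

Definition strategy_events (S : Omega -> strategy n) : set (set Omega) :=
  [set A | exists h g, A = [set w | S w h = g]].

Definition randomized_strategy (S : Omega -> strategy n) : Prop :=
  strategy_events S `<=` measurable.

(* Independence of X from the sigma-algebra generated by S; as 'S_n is finite,
   the events [X = sigma] suffice on the side of X. *)
Definition independent_of_secret (S : Omega -> strategy n) (X : Omega -> 'S_n) :
    Prop :=
  forall (A : set Omega) (sigma : 'S_n), <<s strategy_events S >> A ->
    P (A `&` [set w | X w = sigma]) = (P A * P [set w | X w = sigma])%E.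

Definition expected_guesses (S : Omega -> strategy n) (X : Omega -> 'S_n) :
    \bar R :=
  (\int[P]_w num_guesses R (S w) (X w))%E.

End RandomGame.

(* Main.v *)
Require Import Defs.
From HB Require Import structures.
From mathcomp Require Import all_boot all_order all_algebra all_fingroup.
From mathcomp Require Import all_classical all_reals all_analysis.
From mathcomp Require Import measurable_realfun zify.

(** The lower bound is a linear algebra argument on functions on the symmetric
    group.  Fix a deterministic strategy and let [A_t] be the set of secrets
    that it solves within [t] rounds.  The point is the duality
      [#|A_t| + #|A_(n-t)| <= n!]                        ([card_solved_dual]).
    For [sigma] in [A_t], let [p_sigma (rho)] ([miss_value]) be the product, over all positions
    [i] and all of the first [t] rounds of the run on [sigma] in which the guess
    [v] at [i] is wrong, of [rho i - v].
    - One of these [t] rounds is right everywhere, so each position contributes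
      at most [t - 1] factors: [p_sigma] is a product over [i] of polynomials in
      [rho i] of degree less than [t].
    - [p_sigma (sigma)] is nonzero, and if [p_sigma (rho)] is nonzero then [rho]
      never hits where [sigma] misses.  Hence, at the first round where the
      feedbacks of [rho] and [sigma] differ, that of [rho] is strictly smaller;
      and if they agree for all [t] rounds, then [rho = sigma].
      Ordering the secrets lexicographically by the sizes of their feedbacks,
      the matrix of the [p_sigma] is triangular, so the [p_sigma] with [sigma]
      in [A_t] are linearly independent.
    - For [sigma] in [A_t] and [tau] in [A_(n-t)], the function
      [p_sigma * p_tau] is a product of polynomials in the [rho i] of degree at
      most [n - 2].  Its alternating sum over all [rho] is a determinant
      [\det (f_i (v))] of rank at most [n - 1], thus zero.
    So the sign-twisted pairing makes the spans of the two families orthogonal,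
    and their dimensions add up to at most [n!].

    Summing the duality over [t = 0 .. n] bounds below the total number of pairs
    (secret, number of rounds) in which the secret is still unsolved; this
    number of rounds is at most the number of guesses, which gives [(n + 1) / 2]
    for a uniform secret.  A randomized strategy is handled by applying this to
    each of its values: whether a given secret is unsolved after [t] rounds is an
    event of the sigma-algebra of the strategy, hence independent of the secret
    actually drawn.

    For the circular shift, write [g] for the current guess, a permutation, and
    [tau = g^-1 \o sigma]: the correct value for position [i] now stands at
    [tau i].  A step moves every misplaced value to the next unsolved
    position, and this destroys exactly one excedance [i < tau i], namely the
    one whose value stands at the last unsolved position
    ([card_excedances_rotation]).  So the number of guesses is one plus the
    number of excedances of the secret, and the distribution of
    excedances is symmetric about [(n - 1) / 2] ([sum_card_excedances]). *)

Set Implicit Arguments.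
Unset Strict Implicit.
Unset Printing Implicit Defensive.

Import Order.TTheory GRing.Theory Num.Theory.

Local Open Scope ring_scope.

(** * Solved secrets and their miss polynomials *)

(** The sum is the determinant of [(f i).[a j]].  A polynomial of size at most
    [n] has [n] coefficients, so this matrix of order [n + 1] factors through
    dimension [n]. *)
Lemma alternating_sum_low_degree (F : fieldType) n (a : 'I_n.+1 -> F)
    (f : 'I_n.+1 -> {poly F}) :
  (forall i, (size (f i) <= n)%N) ->
  \sum_(rho : 'S_n.+1) (-1) ^+ rho * \prod_i (f i).[a (rho i)] = 0.
Proof.
move=> size_f; pose M := \matrix_(i, j) (f i).[a j].
have -> : \sum_(rho : 'S_n.+1) (-1) ^+ rho * \prod_i (f i).[a (rho i)] = \det M.
  by apply: eq_bigr => rho _; congr (_ * _); apply: eq_bigr => i _; rewrite mxE.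
have defM : M = (\matrix_(i < n.+1, k < n) (f i)`_k) *m
                (\matrix_(k < n, j < n.+1) a j ^+ k).
  apply/matrixP => i j; rewrite !mxE (horner_coef_wide _ (size_f i)).
  by apply: eq_bigr => k _; rewrite !mxE.
apply/eqP; rewrite -[_ == 0]negbK -unitfE; apply/negP => uM.
have: \rank M = n.+1 by apply/eqP; rewrite -[_ == _]/(row_free M) row_free_unit.
by rewrite defM => rM; have := mulmx_max_rank (\matrix_(i < n.+1, k < n) (f i)`_k)
  (\matrix_(k < n, j < n.+1) a j ^+ k); rewrite rM ltnn.
Qed.

Definition solved_by n (s : strategy n) (t : nat) (sigma : 'S_n) : bool :=
  [exists k : 'I_t, [forall i, guess s sigma k.+1 i == sigma i]].

Section OneStrategy.
Variables (n : nat) (s : strategy n).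
Implicit Types (sigma tau rho : 'S_n) (t : nat).

(** Values have to live in a field to be roots of polynomials. *)
Definition label (v : 'I_n) : rat := (v : nat)%:R.

Definition miss_poly t sigma (i : 'I_n) : {poly rat} :=
  \prod_(a <- [seq label (guess s sigma k.+1 i) | k <- iota 0 t
                 & guess s sigma k.+1 i != sigma i]) ('X - a%:P).

Definition miss_value t sigma rho : rat :=
  \prod_i (miss_poly t sigma i).[label (rho i)].

Lemma label_inj : injective label.
Proof. by move=> u v /eqP; rewrite eqr_nat => /eqP/val_inj. Qed.

(** The round in which the secret is solved contributes no factor, so at most
    [t - 1] of the [t] rounds do. *)
Lemma size_miss_poly t sigma i :
  solved_by s t sigma -> (size (miss_poly t sigma i) <= t)%N.
Proof.
case/existsP=> k /forallP/(_ i) hit; rewrite size_prod_XsubC size_map size_filter.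
rewrite -[X in (_ < X)%N](size_iota 0) ltn_neqAle count_size andbT -all_count.
by apply/allPn; exists (val k); rewrite ?mem_iota //= negbK.
Qed.

Lemma miss_value_eq0 t sigma rho :
  miss_value t sigma rho = 0 <->
  exists2 k, (k < t)%N & exists2 i, guess s sigma k.+1 i != sigma i
                                  & guess s sigma k.+1 i = rho i.
Proof.
split=> [/eqP/prodf_eq0[i _]|[k ltkt [i missi hiti]]].
- rewrite -rootE root_prod_XsubC => /mapP[k]; rewrite mem_filter mem_iota.
  by case/andP=> missi /= ltkt /label_inj e; exists k => //; exists i.
apply/eqP/prodf_eq0; exists i => //; rewrite -rootE root_prod_XsubC -hiti.
by apply: map_f; rewrite mem_filter missi mem_iota.
Qed.

Lemma miss_value_diag t sigma : miss_value t sigma sigma != 0.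
Proof.
by apply/eqP=> /miss_value_eq0[k _ [i /eqP]].
Qed.

(** Feedback sizes as the digits of a number in base [n + 1]: comparing these
    numbers is comparing the sequences of sizes lexicographically. *)
Fixpoint hit_key t sigma : nat :=
  if t is k.+1 then (hit_key k sigma * n.+1 + #|feedback (guess s sigma t) sigma|)%N
  else 0%N.

Lemma hit_key_eq t sigma rho :
  history s sigma t = history s rho t -> hit_key t rho = hit_key t sigma.
Proof.
by elim: t => //= t IHt /rcons_inj[eqh equ]; rewrite IHt // /guess /= equ.
Qed.

(** As long as the two runs have received the same feedback they make the same
    guess, and a nonzero value says that [rho] is not hit where [sigma] is missed.
    So when the feedbacks first differ, that of [rho] is a proper subset. *)
Lemma miss_value_neq0_key t sigma rho : miss_value t sigma rho != 0 ->
  history s sigma t = history s rho t \/ (hit_key t rho < hit_key t sigma)%N.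
Proof.
elim: t => [|t IHt] nz; first by left.
have [eqh|lth] : history s sigma t = history s rho t \/
    (hit_key t rho < hit_key t sigma)%N.
- apply: IHt; apply: contra_neq nz => /miss_value_eq0[k ltkt iP]; apply/miss_value_eq0.
  by exists k => //; apply: ltnW.
- have eqg : guess s rho t.+1 = guess s sigma t.+1 by rewrite /guess /= eqh.
  have eqk := hit_key_eq eqh.
  have sub : feedback (guess s sigma t.+1) rho \subset feedback (guess s sigma t.+1) sigma.
    apply/fintype.subsetP=> i; rewrite !inE => /eqP hiti; apply: contraNT nz => missi.
    by apply/eqP/miss_value_eq0; exists t => //; exists i.
  have [equ|neu] := eqVneq (feedback (guess s sigma t.+1) rho)
                           (feedback (guess s sigma t.+1) sigma).
    by left; rewrite /= eqh; congr rcons; rewrite -eqh; exact/esym.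
  right; rewrite /= eqk eqg ltn_add2l; apply: proper_card.
  by rewrite finset.properEneq neu.
right=> /=; apply: (@leq_trans ((hit_key t rho).+1 * n.+1)).
  rewrite mulSn addnC ltn_add2r ltnS -[X in (_ <= X)%N](card_ord n).
  exact: max_card.
by rewrite (leq_trans _ (leq_addr _ _)) // leq_mul2r lth orbT.
Qed.

(** A secret that is solved receives a full feedback, which determines it. *)
Lemma history_eq_solved t sigma rho :
  solved_by s t sigma -> history s sigma t = history s rho t -> rho = sigma.
Proof.
case/existsP=> k /forallP hit eqh.
have eqhk m : (m <= t)%N -> history s sigma m = history s rho m.
  move=> lemt; rewrite -(subnK lemt) in eqh.
  by elim: (t - m)%N eqh => //= d IHd /rcons_inj[eqd _]; apply: IHd.
have /= /rcons_inj[eqk equ] := eqhk k.+1 (ltn_ord k).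
apply/permP=> i; apply/esym/eqP; rewrite -(eqP (hit i)).
have: i \in feedback (s (history s sigma k)) sigma by rewrite inE; apply: hit.
by rewrite equ inE -eqk.
Qed.

Lemma miss_value_triangular t sigma rho :
  solved_by s t sigma -> miss_value t sigma rho != 0 ->
  rho = sigma \/ (hit_key t rho < hit_key t sigma)%N.
Proof.
move=> solved /miss_value_neq0_key[eqh|]; [left | by right].
exact: history_eq_solved solved eqh.
Qed.

Definition solved t := [set sigma | solved_by s t sigma]%SET.

Definition miss_mx t : 'M[rat]_(#|solved t|, #|{: 'S_n}|) :=
  \matrix_(a, b) miss_value t (enum_val a) (enum_val b).

(** In a vanishing combination of rows, look at the row with the largest key among
    those with a nonzero coefficient: in its own diagonal column every other such
    row is zero, by triangularity. *)
Lemma miss_mx_free t : row_free (miss_mx t).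
Proof.
apply: inj_row_free => v v0; apply/eqP; apply: contraT => /rV0Pn[a0 nza0].
have [a nza maxa] := @arg_maxnP _ a0 (fun a => v 0 a != 0)
  (fun a => hit_key t (enum_val a)) nza0.
have := congr1 (fun M : 'rV_ _ => M 0 (enum_rank (enum_val a))) v0.
rewrite !mxE (bigD1 a) //= mxE enum_rankK big1 ?addr0 => [/eqP|b neba].
  by rewrite mulf_eq0 (negPf nza) (negPf (miss_value_diag _ _)).
rewrite mxE enum_rankK; have [->|nzb] := eqVneq (v 0 b) 0; first by rewrite mul0r.
have [->|] := eqVneq (miss_value t (enum_val b) (enum_val a)) 0; first by rewrite mulr0.
have := enum_valP b; rewrite inE => solvedb /(miss_value_triangular solvedb)[eqab|].
  by rewrite (enum_val_inj eqab) eqxx in neba.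
by rewrite ltnNge; have /= -> := maxa b nzb.
Qed.

End OneStrategy.

Definition sign_mx n : 'M[rat]_#|{: 'S_n}| :=
  diag_mx (\row_b (-1) ^+ (enum_val b : 'S_n)).

(** The two families of functions are free and orthogonal for the pairing
    twisted by the signature, because the product of one function from each is
    of degree at most [(t - 1) + (n - t - 1) = n - 2] in every [rho i]. *)
Lemma card_solved_dual n (s : strategy n) t : (0 < n)%N -> (t <= n)%N ->
  (#|solved s t| + #|solved s (n - t)| <= n`!)%N.
Proof.
case: n s => // n s _ le_tn.
pose D := sign_mx n.+1.
have unitD : D \in unitmx.
  by rewrite unitmxE det_diag unitfE; apply/prodf_neq0 => b _; rewrite mxE signr_eq0.
have ortho : miss_mx s t *m (D *m (miss_mx s (n.+1 - t))^T) = 0.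
  apply/matrixP => a b; rewrite mulmxA /D mul_mx_diag !mxE.
  set sigma := enum_val a; set tau := enum_val b.
  pose f i := miss_poly s t sigma i * miss_poly s (n.+1 - t) tau i.
  rewrite -[RHS](alternating_sum_low_degree (@label n.+1) (f := f)); last first.
    (* Sizes are degrees plus one: [size (f i) <= t + (n.+1 - t) - 1]. *)
    move=> i; have := enum_valP a; have := enum_valP b; rewrite !inE => sb sa.
    apply: leq_trans (size_polyMleq _ _) _.
    move: (size_miss_poly i sa) (size_miss_poly i sb).
    rewrite -/sigma -/tau; move: (size _) (size _) => x y le_xt le_yt.
    rewrite -subn1 leq_subLR add1n (leq_trans (leq_add le_xt le_yt)) //.
    by rewrite subnKC.
  rewrite [RHS](reindex (@enum_val 'S_n.+1 {: 'S_n.+1})) /=; last first.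
    exact/onW_bij/enum_val_bij.
  apply: eq_bigr => c _; rewrite !mxE mulrAC mulrC -big_split /=.
  by congr (_ * _); apply: eq_bigr => i _; rewrite hornerM.
have := mulmx0_rank_max ortho.
rewrite (eqmxMfull _ (_ : row_full D)) ?row_full_unit // mxrank_tr.
by rewrite !(eqP (miss_mx_free _ _)) card_Sn.
Qed.

(** Pair the term [t] with the term [n - t]: by duality, the numbers of unsolved
    secrets add up to at least [n!] in each of the [n + 1] pairs. *)
Lemma sum_card_unsolved n (s : strategy n) : (0 < n)%N ->
  (n.+1 * n`! <= (\sum_(t < n.+1) #|[set sigma | ~~ solved_by s t sigma]%SET|).*2)%N.
Proof.
move=> n_gt0.
have cardC (t : 'I_n.+1) :
    #|[set sigma | ~~ solved_by s t sigma]%SET| = (n`! - #|solved s t|)%N.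
  rewrite -card_Sn -(cardsC (solved s t)) addKn; apply: eq_card => sigma.
  by rewrite !inE.
rewrite -addnn {2}(reindex_inj rev_ord_inj) -big_split /=.
rewrite -[X in (X * _)%N](card_ord n.+1) -sum_nat_const; apply: leq_sum => t _.
have le_tn : (t <= n)%N by rewrite -ltnS.
have := cardC (rev_ord t); rewrite /= subSS => ->; rewrite cardC.
have := card_solved_dual s n_gt0 le_tn; move: #|_| #|_| => a b. lia.
Qed.

(** * Excedances and the circular shift *)

Section CyclicOrder.
Variables (n : nat) (A : {set 'I_n}).
Local Notation e := (enum A).

Lemma ltn_index_enum : {in A &, forall i j : 'I_n,
  (index i e < index j e)%N = (i < j)%N}.
Proof.
have sorted_e : sorted (relpre val ltn) e.
  rewrite /enum_mem -enumT sorted_filter //; first by move=> ? ? ?; apply: ltn_trans.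
  by rewrite -sorted_map val_enum_ord iota_ltn_sorted.
have tr : transitive (relpre (val : 'I_n -> nat) ltn) by move=> ? ? ?; apply: ltn_trans.
have mono := sorted_ltn_index tr sorted_e.
move=> i j; rewrite -!(mem_enum A) => Ai Aj.
have [ltij|ltji|eqij] := ltngtP (index i e) (index j e).
- by have /= -> := mono _ _ Ai Aj ltij.
- by apply/esym/negbTE; rewrite -leqNgt ltnW //; apply: (mono _ _ Aj Ai).
by rewrite -(nth_index i Ai) eqij nth_index // ltnn.
Qed.

Lemma index_next i : i \in A ->
  index (next e i) e = if (index i e).+1 == #|A| then 0%N else (index i e).+1.
Proof.
rewrite -mem_enum cardE next_nth => Ai; rewrite Ai.
have := enum_uniq A; case: e Ai => // y p Ai Up; rewrite -index_mem in Ai.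
rewrite [size _]/= eqSS; have [->|neq] := eqVneq.
  by rewrite nth_default //= eqxx.
rewrite -[nth y p _]/(nth y (y :: p) (index i (y :: p)).+1) index_uniq //.
by rewrite /= ltnS ltn_neqAle neq -ltnS.
Qed.

Lemma next_in i : (next e i \in A) = (i \in A).
Proof. by rewrite -!(mem_enum A) mem_next. Qed.

(** The successor of the last element of [A] is the first one, which exceeds
    nothing in [A]; the successor of any other [j] is the least element of [A]
    above [j], and exceeds the same [i != j] in [A] as [j] does. *)
Lemma lt_next i j : i \in A -> j \in A -> i != j ->
  (i < next e j)%N = (i < j)%N && ((index j e).+1 != #|A|).
Proof.
move=> Ai Aj neqij; rewrite -!ltn_index_enum ?next_in // index_next //.
have [_|_] := eqVneq; rewrite ?andbF ?andbT // ltnS leq_eqVlt.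
suff /negPf-> : index i e != index j e by [].
by apply: contraNneq neqij => eqij; rewrite -(nth_index i (s := e) (x := i)) ?mem_enum // eqij nth_index ?mem_enum.
Qed.
End CyclicOrder.

Definition excedances n (tau : 'S_n) : {set 'I_n} := [set i : 'I_n | (i < tau i)%N]%SET.

Definition rotation n (A : {set 'I_n}) : 'S_n :=
  perm (can_inj (prev_next (enum_uniq A))).

Definition moved n (tau : 'S_n) : {set 'I_n} := [set i : 'I_n | tau i != i]%SET.

Lemma moved_perm n (tau : 'S_n) i : (tau i \in moved tau) = (i \in moved tau).
Proof. by rewrite !inE (inj_eq perm_inj). Qed.

(** An excedance of [tau] remains one after the rotation unless its image is the
    last moved point [m], and no new one appears ([lt_next]).  The preimage [i0]
    of [m] is itself moved, hence smaller than [m]: it is the only excedance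
    lost. *)
Lemma card_excedances_rotation n (tau : 'S_n) : moved tau != finset.set0 ->
  #|excedances (tau * rotation (moved tau))%g|.+1 = #|excedances tau|.
Proof.
set A := moved tau => A_neq0.
have fixed i : i \notin A -> tau i = i by rewrite inE negbK => /eqP.
have rotE i : rotation A i = next (enum A) i by rewrite permE.
have rot_fixed i : i \notin A -> rotation A i = i.
  by move=> notAi; rewrite rotE next_nth mem_enum (negPf notAi).
have cardA_gt0 : (0 < #|A|)%N by rewrite card_gt0.
have [m Am last_m] : exists2 m, m \in A & (index m (enum A)).+1 = #|A|.
  have [x0 Ax0] := finset.set0Pn _ A_neq0.
  have lt_size : (#|A|.-1 < size (enum A))%N by rewrite -cardE ltn_predL.
  exists (nth x0 (enum A) #|A|.-1); first by rewrite -mem_enum mem_nth.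
  by rewrite index_uniq ?enum_uniq // prednK.
have last_uniq j : j \in A -> ((index j (enum A)).+1 == #|A|) = (j == m).
  move=> Aj; rewrite -last_m eqSS; apply/eqP/eqP => [eqjm|-> //].
  by rewrite -(nth_index m (s := enum A) (x := j)) ?mem_enum // eqjm nth_index ?mem_enum.
pose i0 := (tau^-1)%g m.
have tau_i0 : tau i0 = m by rewrite permKV.
have Ai0 : i0 \in A by rewrite -moved_perm tau_i0.
have exc_i0 : i0 \in excedances tau.
  rewrite inE tau_i0 -(ltn_index_enum Ai0 Am) -ltnS last_m ltn_neqAle.
  rewrite cardE index_mem mem_enum Ai0 andbT -cardE last_uniq //.
  by have := Ai0; rewrite inE tau_i0 eq_sym.
rewrite [RHS](cardsD1 i0) exc_i0 add1n; congr _.+1; apply: eq_card => i.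
rewrite !inE permM; case Ai: (i \in A); last first.
  by rewrite fixed ?Ai // rot_fixed ?Ai // ltnn andbF.
have neqi : i != tau i by move: Ai; rewrite inE eq_sym.
rewrite rotE lt_next ?moved_perm // last_uniq ?moved_perm // andbC; congr (~~ _ && _).
by rewrite -(inj_eq (@perm_inj _ tau) i) tau_i0.
Qed.

(** A permutation that moves something has an excedance, since a rotation of it
    has one fewer. *)
Lemma excedances0P n (tau : 'S_n) : (#|excedances tau| == 0%N) = (tau == 1%g).
Proof.
apply/idP/idP => [exc0|/eqP->]; last first.
  by apply/eqP/eq_card0 => i; rewrite inE perm1 ltnn.
have moved0 : moved tau = finset.set0.
  apply/eqP; apply: contraTT exc0 => /card_excedances_rotation <-.
  by [].
apply/eqP/permP=> i; rewrite perm1; apply/eqP.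
by have := finset.in_set0 i; rewrite -moved0 inE => /negbFE.
Qed.

Section CircularShift.
Variables (n : nat) (sigma : 'S_n).

Definition perm_word (g : 'S_n) : word n := [ffun i => g i].

(** Products of permutations compose from left to right, so that
    [sigma * g^-1] sends [i] to the position where [g] has the value [sigma i];
    the points it moves are the positions not yet solved. *)
Lemma circular_step_perm (g : 'S_n) :
  let tau := (sigma * g^-1)%g in
  circular_step (perm_word g) (feedback (perm_word g) sigma)
    = perm_word ((rotation (moved tau))^-1 * g)%g.
Proof.
move=> tau; have -> : moved tau = (~: feedback (perm_word g) sigma)%SET.
  apply/setP=> i; rewrite !inE permM ffunE -(inj_eq (@perm_inj _ g)) permKV.
  by rewrite eq_sym.
set A := (~: _)%SET; apply/ffunP=> i; rewrite !ffunE permM.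
have -> : (rotation A)^-1%g i = prev (enum A) i.
  by apply: (@perm_inj _ (rotation A)); rewrite permKV permE next_prev ?enum_uniq.
by case: ifP => // Ui; rewrite prev_nth mem_enum inE Ui.
Qed.

(** The truncated subtraction covers the rounds after the secret is solved, in
    which the guess no longer changes. *)
Lemma guess_circular_shift k : exists g : 'S_n,
  guess (@circular_shift n) sigma k.+1 = perm_word g /\
  #|excedances (sigma * g^-1)%g| = (#|excedances sigma| - k)%N.
Proof.
elim: k => [|k [g [guess_g exc_g]]].
  exists 1%g; rewrite invg1 mulg1 subn0; split=> //.
  by apply/ffunP=> i; rewrite !ffunE perm1.
set tau := (sigma * g^-1)%g in exc_g.
exists ((rotation (moved tau))^-1 * g)%g; split.
  rewrite -circular_step_perm -guess_g /guess /= {1}/circular_shift foldl_rcons.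
  by [].
rewrite invMg invgK mulgA -/tau subnS -exc_g.
have [moved0|/card_excedances_rotation <- //] := eqVneq (moved tau) finset.set0.
have tau1 : tau = 1%g.
  apply/permP=> i; rewrite perm1; apply/eqP.
  by have := finset.in_set0 i; rewrite -moved0 inE => /negbFE.
have -> : rotation (moved tau) = 1%g.
  apply/permP=> i; rewrite permE perm1 next_nth mem_enum moved0 inE //.
by rewrite mulg1 tau1; have /eqP-> : #|excedances (1%g : 'S_n)| == 0%N
  by rewrite excedances0P.
Qed.

Lemma circular_shift_solved k :
  [forall i, guess (@circular_shift n) sigma k.+1 i == sigma i]
    = (#|excedances sigma| <= k)%N.
Proof.
have [g [-> exc_g]] := guess_circular_shift k.
rewrite -subn_eq0 -exc_g excedances0P.
apply/forallP/eqP => [hit|tau1 i].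
  by apply/permP=> i; rewrite permM -(eqP (hit i)) ffunE permK perm1.
by rewrite ffunE -[sigma](mulgKV g) tau1 mul1g.
Qed.

End CircularShift.

(** With the [n]-cycle [c : i |-> i + 1], the bijection
    [sigma |-> c \o sigma^-1] maps a permutation with [k] excedances to one with
    [n - 1 - k]: for [i = sigma j], the inequality [i < c (sigma^-1 i)] reads
    [sigma j <= j] with [j] not the last point, while the last point is never an
    excedance. *)
Lemma sum_card_excedances n : (0 < n)%N ->
  ((\sum_(sigma : 'S_n) #|excedances sigma|).*2 = n`! * n.-1)%N.
Proof.
case: n => // n _; pose c : 'S_n.+1 := perm (can_inj (@ordSK n.+1)).
have exc_dual (sigma : 'S_n.+1) :
    (#|excedances (sigma^-1 * c)%g| + #|excedances sigma| = n)%N.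
  apply: succn_inj; rewrite -addSn addnC -[RHS](card_ord n.+1) -(cardsC (excedances sigma)).
  congr (_ + _)%N; rewrite [RHS](cardsD1 ord_max) !inE -leqNgt -ltnS ltn_ord add1n.
  congr _.+1; rewrite -(card_preimset _ (@perm_inj _ sigma)); apply: eq_card => j.
  rewrite !inE permM permK permE /= -leqNgt -val_eqE /=.
  have [->|neq_jn] := eqVneq (val j) n; first by rewrite modnn.
  by rewrite modn_small ?ltnS // ltn_neqAle neq_jn -ltnS ltn_ord.
rewrite -addnn {1}(reindex_inj (h := fun sigma => sigma^-1 * c)%g) /=; last first.
  by move=> s1 s2 /mulIg/invg_inj.
rewrite -big_split /= (eq_bigr _ (fun sigma _ => exc_dual sigma)).
by rewrite sum_nat_const card_Sn.
Qed.

Local Open Scope classical_set_scope.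

(** * The number of guesses *)

Section NumGuesses.
Variables (R : realType) (n : nat) (s : strategy n) (sigma : 'S_n).

Lemma count_unsolved_le_num_guesses m :
  (((\sum_(t < m) ~~ solved_by s t sigma)%N%:R : R)%:E <= num_guesses R s sigma)%E.
Proof.
apply: le_ereal_inf_tmp => _ [r [r_gt0 hit] <-]; rewrite lee_fin ler_nat.
have late (t : nat) : (r <= t)%N -> solved_by s t sigma.
  case: r r_gt0 hit => // k _ hit ltkt; apply/existsP; exists (Ordinal ltkt).
  by apply/forallP=> i; rewrite /= hit.
have le_sum : (\sum_(t < m) ~~ solved_by s t sigma <= \sum_(t < m) (t < r))%N.
  by apply: leq_sum => t _; have [/late->|_] := leqP r t; last exact: leq_b1.
apply: leq_trans le_sum _; elim: m => [|m IHm]; first by rewrite big_ord0.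
rewrite big_ord_recr /=; have [ltmr|lermr] := ltnP; last by rewrite addn0.
rewrite addn1; apply: leq_trans ltmr; rewrite ltnS.
by rewrite -[leqRHS](card_ord m) -sum1_card; apply: leq_sum => i _; apply: leq_b1.
Qed.

Lemma num_guesses_circular_shift :
  num_guesses R (@circular_shift n) sigma = #|excedances sigma|.+1%:R%:E.
Proof.
have hitP k : guess (@circular_shift n) sigma k.+1 =1 sigma <->
    (#|excedances sigma| <= k)%N.
  rewrite -circular_shift_solved.
  by split=> [hit|/forallP hit i]; [apply/forallP=> i; rewrite hit | apply/eqP].
apply/eqP; rewrite eq_le; apply/andP; split.
  apply: ereal_inf_lbound; exists #|excedances sigma|.+1 => //.
  by split=> //; apply/hitP.
apply: le_ereal_inf_tmp => _ [[|k] [//]  _ /hitP le_k <-].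
by rewrite lee_fin ler_nat.
Qed.

End NumGuesses.

(** * Integrals of counts *)

(** The integral of a nonnegative function is the supremum of the integrals of the
    simple functions below it, so it is monotone even where measurability of [g]
    is not known.  Here [g] is the number of guesses of a random strategy. *)
Lemma le_integral_nonneg d (T : measurableType d) (R : realType)
    (mu : {measure set T -> \bar R}) (f g : T -> \bar R) :
  (forall x, 0 <= f x)%E -> (forall x, f x <= g x)%E ->
  (\int[mu]_x f x <= \int[mu]_x g x)%E.
Proof.
move=> f_ge0 le_fg; rewrite !ge0_integralTE //; last first.
  by move=> x; apply: le_trans (f_ge0 x) (le_fg x).
apply: ereal_sup_le => _ [h le_hf <-].
by exists h => //= x; apply: le_trans (le_hf x) (le_fg x).
Qed.

Lemma integral_weighted_count d (T : measurableType d) (R : realType)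
    (mu : {measure set T -> \bar R}) (I : finType) (c : I -> nat) (e : I -> pred T) :
  (forall i, measurable [set w | e i w]) ->
  (\int[mu]_w ((\sum_i c i * e i w)%N%:R%:E)
    = \sum_i (c i)%:R%:E * mu [set w | e i w])%E.
Proof.
move=> me.
pose f i : T -> \bar R := fun w => ((c i)%:R%:E * (\1_[set w | e i w] w)%:E)%E.
have mf i : measurable_fun setT (f i).
  by apply: measurable_funeM; apply/measurable_EFinP/measurable_indic.
transitivity (\int[mu]_w (\sum_i ((c i)%:R%:E * (\1_[set w | e i w] w)%:E)))%E.
  apply: eq_integral => w _; rewrite natr_sum -sumEFin; apply: eq_bigr => i _.
  rewrite natrM EFinM indicE; congr (_ * (_ %:R)%:E)%E.
  by congr nat_of_bool; apply/idP/idP; rewrite inE.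
rewrite ge0_integral_sum //.
apply: eq_bigr => i _; rewrite ge0_integralZl_EFin //; last first.
  exact/measurable_EFinP/measurable_indic.
by rewrite integral_indic ?setIT.
Qed.

(** * The unsolved events of a random strategy *)

Section DiscreteMeasurability.
Context d (T : measurableType d).

(** Measurability for the discrete sigma-algebra on the target, which is an
    arbitrary type such as the lists of feedbacks. *)
Definition discrete_fun (U : Type) (f : T -> U) := forall A, measurable (f @^-1` A).

Lemma discrete_fun_finite (U : finType) (f : T -> U) :
  (forall u, measurable [set w | f w = u]) -> discrete_fun f.
Proof.
move=> mf A.
have -> : f @^-1` A = \bigcup_(u in A) [set w | f w = u].
  apply/seteqP; split=> [w Aw|w [u Au /= eq_u]]; first by exists (f w).
  by rewrite /preimage /= eq_u.
by apply: fin_bigcup_measurable.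
Qed.

(** A measurable choice [f] among countably many measurable maps is
    measurable; it makes the next guess, read off a random strategy at a random
    history, measurable. *)
Lemma discrete_fun_bind (U : countType) (V : Type) (f : T -> U) (g : T -> U -> V) :
  discrete_fun f -> (forall u, discrete_fun (g^~ u)) ->
  discrete_fun (fun w => g w (f w)).
Proof.
move=> mf mg A.
have -> : (fun w => g w (f w)) @^-1` A =
    \bigcup_u (f @^-1` [set u] `&` (g^~ u) @^-1` A).
  by apply/seteqP; split=> [w Aw|w [u _ [/= <-]]] //; exists (f w).
apply: countable_bigcupT_measurable; first exact: countableP.
by move=> u; apply: measurableI; [apply: mf | apply: mg].
Qed.

Variables (n : nat) (S : T -> strategy n).
Hypothesis mS : forall h g, measurable [set w | S w h = g].

Lemma discrete_history sigma k : discrete_fun (fun w => history (S w) sigma k).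
Proof.
elim: k => [|k IHk] /=.
  by move=> A; rewrite preimage_cst; case: ifP.
apply: (discrete_fun_bind (g := fun w h => rcons h (feedback (S w h) sigma))) => // h A.
exact: (discrete_fun_finite (mS h)
  [set g | A (rcons h (feedback g sigma))]).
Qed.

Lemma measurable_unsolved t sigma :
  measurable [set w | ~~ solved_by (S w) t sigma].
Proof.
have -> : [set w | ~~ solved_by (S w) t sigma] =
    ~` \bigcup_(k in `I_t) [set w | guess (S w) sigma k.+1 =1 sigma].
  apply/seteqP; split=> w /= => [/existsP uns [k ltkt hit]|uns].
    by apply: uns; exists (Ordinal ltkt); apply/forallP=> i; apply/eqP/hit.
  apply/existsP=> -[k /forallP hit]; apply: uns; exists (val k) => //= i.
  exact/eqP.
apply: measurableC; apply: bigcup_measurable => k _.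
apply: (discrete_fun_bind (g := fun w h => S w h) (@discrete_history sigma k) _
  [set g : word n | g =1 sigma]) => h.
exact: discrete_fun_finite.
Qed.

End DiscreteMeasurability.

(** * Expected number of guesses *)

Section RandomGame.
Context (R : realType) (n : nat) (d : measure_display) (Omega : measurableType d).
Variables (P : probability Omega R) (X : Omega -> 'S_n).
Hypothesis unifX : uniform_secret P X.

Lemma expected_circular_shift : (0 < n)%N ->
  expected_guesses P (fun _ => @circular_shift n) X = ((n + 1)%:R / 2)%:E.
Proof.
move=> n_gt0; pose c (sigma : 'S_n) := #|excedances sigma|.+1.
rewrite /expected_guesses.
(* A function of the secret is a weighted count of the events [X = sigma]. *)
transitivity (\int[P]_w ((\sum_sigma c sigma * (X w == sigma))%N%:R%:E))%E.
  apply: eq_integral => w _; rewrite num_guesses_circular_shift.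
  rewrite (bigD1 (X w)) //= eqxx muln1 big1 ?addn0 // => sigma /negPf.
  by rewrite eq_sym => ->; rewrite muln0.
have eqX (sigma : 'S_n) : [set w | X w == sigma] = [set w | X w = sigma].
  by apply/seteqP; split=> w /= /eqP.
rewrite integral_weighted_count => [|sigma]; last by rewrite eqX; case: (unifX sigma).
transitivity (\sum_(sigma : 'S_n) ((c sigma)%:R * n`!%:R^-1)%:E : \bar R)%E.
  by apply: eq_bigr => sigma _; rewrite eqX EFinM; congr (_ * _)%E; case: (unifX sigma).
rewrite sumEFin -big_distrl -natr_sum /=; congr _%:E.
have fact_neq0 : n`!%:R != 0 :> R by rewrite pnatr_eq0 -lt0n fact_gt0.
apply: (canLR (mulfK fact_neq0)); rewrite mulrAC; apply: (canRL (mulfK _)) => //.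
rewrite -!natrM; congr _%:R; rewrite muln2 /c.
have -> : (\sum_(sigma : 'S_n) #|excedances sigma|.+1 =
    \sum_(sigma : 'S_n) #|excedances sigma| + n`!)%N.
  transitivity (\sum_(sigma : 'S_n) (#|excedances sigma| + 1))%N.
    by apply: eq_bigr => sigma _; rewrite addn1.
  by rewrite big_split /= sum_nat_const card_Sn muln1.
rewrite doubleD sum_card_excedances //; case: n n_gt0 => // m _ /=; lia.
Qed.

Variable S : Omega -> strategy n.
Hypothesis measS : randomized_strategy S.
Hypothesis indep : independent_of_secret P S X.

Lemma unsolved_secretE t sigma :
  [set w | ~~ solved_by (S w) t (X w) && (X w == sigma)]
    = [set w | ~~ solved_by (S w) t sigma] `&` [set w | X w = sigma].
Proof.
apply/seteqP; split=> w /= => [/andP[uns /eqP eqX]|[uns eqX]].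
  by rewrite -eqX.
by rewrite eqX uns eqxx.
Qed.

(** Independence is assumed for the sigma-algebra generated by the strategy, so
    the unsolved event is shown measurable for that one. *)
Lemma prob_unsolved t sigma :
  (P [set w | ~~ solved_by (S w) t (X w) && (X w == sigma)]
    = P [set w | ~~ solved_by (S w) t sigma] * (n`!%:R^-1)%:E)%E.
Proof.
rewrite unsolved_secretE -(unifX sigma).2 indep //.
apply: (@measurable_unsolved _ (g_sigma_algebraType (strategy_events S)) n S).
by move=> h g; apply: sub_sigma_algebra; exists h, g.
Qed.

(** The number of guesses is at least the number of pairs [(t, sigma)] such that
    the secret is [sigma] and is unsolved after [t] rounds.  By independence, its
    expectation is [1 / n!] times the expected number of pairs for which
    [sigma] would be unsolved, a number that [sum_card_unsolved] bounds for every
    value of the random strategy. *)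
Lemma expected_guesses_ge : (0 < n)%N ->
  (((n + 1)%:R / 2)%:E <= expected_guesses P S X)%E.
Proof.
move=> n_gt0; pose I : finType := ('I_n.+1 * 'S_n)%type.
have mB (t : nat) sigma : measurable [set w | ~~ solved_by (S w) t sigma].
  by apply: measurable_unsolved => h g; apply: measS; exists h, g.
have mBX (t : nat) sigma :
    measurable [set w | ~~ solved_by (S w) t (X w) && (X w == sigma)].
  by rewrite unsolved_secretE; apply: measurableI => //; case: (unifX sigma).
have sumB : (((n.+1 * n`!)%:R / 2)%:E <=
    \sum_(i : I) P [set w | ~~ solved_by (S w) i.1 i.2])%E.
  have -> : (\sum_(i : I) P [set w | ~~ solved_by (S w) i.1 i.2] =
      \int[P]_w ((\sum_(i : I) 1 * ~~ solved_by (S w) i.1 i.2)%N%:R%:E))%E.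
    rewrite (integral_weighted_count P (fun=> 1%N)
      (e := fun (i : I) w => ~~ solved_by (S w) i.1 i.2)) //.
    by apply: eq_bigr => i _; rewrite mul1e.
  rewrite -[leLHS]mule1 -(probability_setT P) -integral_cst //.
  apply: le_integral_nonneg => w /=; first by rewrite lee_fin divr_ge0.
  rewrite lee_fin ler_pdivrMr // -natrM ler_nat muln2.
  apply: leq_trans (sum_card_unsolved (S w) n_gt0) _; rewrite leq_double.
  rewrite -(pair_bigA _ (fun (t : 'I_n.+1) (sigma : 'S_n) => 1 * ~~ solved_by (S w) t sigma)%N) /=.
  apply: leq_sum => t _; rewrite -sum1_card big_mkcond; apply: leq_sum => sigma _.
  by rewrite inE; case: solved_by.
apply: (@le_trans _ _ (\int[P]_w ((\sum_(i : I)
    1 * (~~ solved_by (S w) i.1 (X w) && (X w == i.2)))%N%:R%:E))%E); last first.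
  apply: le_integral_nonneg => w; first by rewrite lee_fin.
  apply: le_trans (count_unsolved_le_num_guesses R (S w) (X w) n.+1).
  rewrite lee_fin ler_nat.
  rewrite -(pair_bigA _ (fun (t : 'I_n.+1) (sigma : 'S_n) =>
    1 * (~~ solved_by (S w) t (X w) && (X w == sigma)))%N) /=.
  apply: leq_sum => t _; rewrite (bigD1 (X w)) //= eqxx andbT mul1n.
  by rewrite big1 ?addn0 // => sigma /negPf; rewrite eq_sym => ->; rewrite andbF.
rewrite (integral_weighted_count P (fun=> 1%N)
      (e := fun (i : I) w => ~~ solved_by (S w) i.1 (X w) && (X w == i.2))) //.
rewrite (eq_bigr (fun i : I =>
    P [set w | ~~ solved_by (S w) i.1 i.2] * (n`!%:R^-1)%:E)%E); last first.
  by move=> i _; rewrite mul1e; apply: prob_unsolved.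
rewrite -ge0_sume_distrl //.
have fact_gt0R : 0 < n`!%:R :> R by rewrite ltr0n fact_gt0.
rewrite lee_pdivlMr //; apply: le_trans sumB.
by rewrite -EFinM lee_fin natrM addn1 mulrAC.
Qed.

End RandomGame.

Theorem corollary12 (R : realType) (n : nat) (n_gt0 : (0 < n)%N) :
  (forall (d : measure_display) (Omega : measurableType d)
          (P : probability Omega R)
          (X : Omega -> 'S_n) (S : Omega -> strategy n),
      uniform_secret P X ->
      randomized_strategy S ->
      independent_of_secret P S X ->
      (((n + 1)%:R / 2)%:E <= expected_guesses P S X)%E)
  /\
  (forall (d : measure_display) (Omega : measurableType d)
          (P : probability Omega R) (X : Omega -> 'S_n),
      uniform_secret P X ->
      expected_guesses P (fun _ => @circular_shift n) X
        = ((n + 1)%:R / 2)%:E).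
Proof.
split=> [d Omega P X S unifX measS indep|d Omega P X unifX].
  exact: expected_guesses_ge.
exact: expected_circular_shift.
Qed.
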